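(* Define finite words over $\{0,1\}$ by $A_1=10111$ and $A_{n+1}=A_nO_nA_nI_nA_n$ for $n\ge1$, where $O_n$ (respectively $I_n$) is the word of the same length as $A_n$ consisting only of $0$'s (respectively only of $1$'s). Let $u\in\{0,1\}^{\{0,1,2,\dots\}}$ be the infinite sequence having every $A_n$ as a prefix, let $\sigma$ be the shift map, let $X=\omega(u,\sigma)$ be the $\omega$-limit set of $u$ under $\sigma$, and let $a=000\cdots$ and $b=111\cdots$. Let $f_0:X\to X$ be the constant map $f_0\equiv a$, and let $F=\{\sigma,f_0\}$, with $\sigma$ restricted to $X$. Then $(X,F)$ has exactly two strongly nonwandering points, namely $a$ and $b$, and $(X,F)$ is Hausdorff metric distributionally chaotic.
   Context: The sequence space $\Sigma_2=\{a_0a_1a_2\cdots\mid a_i\in\{0,1\}\}$ has the metric $\rho(\alpha,\beta)=\sum_{i=0}^\infty d(a_i,b_i)/2^i$ for $\alpha=a_0a_1\cdots$, $\beta=b_0b_1\cdots$, where $d(a_i,b_i)=1$ if $a_i\neq b_i$ and $0$ otherwise. The shift is $\sigma(a_0a_1a_2\cdots)=a_1a_2\cdots$. $X\subset\Sigma_2$ carries the restricted metric, and $a,b\in X$. For a tuple $F=\{f_1,\dots,f_m\}$ of continuous self-maps of a compact metric space $X$, $F^n(x)=\{f_{i_1}\circ\cdots\circ f_{i_n}(x)\mid i_1,\dots,i_n\in\{1,\dots,m\}\}$ for $n\ge1$, and $F^0(x)=\{x\}$. $d_H$ denotes the Hausdorff metric on nonempty compact subsets of $X$ induced by the metric of $X$.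 Strongly nonwandering point: $x\in X$ is a strongly nonwandering point of $F$ if for any open neighborhood $V$ of $x$ there is $y\in X$ with $\limsup_{n\to\infty}\frac1n\#\{0\le i\le n-1\mid F^i(y)\cap V\neq\emptyset\}>0$. Hausdorff metric distributional chaos: there is an uncountable set $S\subset X$ such that for all $x,y\in S$ with $x\neq y$, $$\limsup_{n\to\infty}\tfrac1n\#\{0\le i\le n-1\mid d_H(F^i(x),F^i(y))<t\}=1\ \text{ for all } t>0,$$ and, for some $\varepsilon>0$, $$\liminf_{n\to\infty}\tfrac1n\#\{0\le i\le n-1\mid d_H(F^i(x),F^i(y))<\varepsilon\}=0.$$ *)

(* Defs.v *)
From HB Require Import structures.
From mathcomp Require Import all_boot all_order all_algebra.
From mathcomp Require Import all_classical all_reals all_analysis.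
From mathcomp Require Import zify ring lra.

Set Implicit Arguments.
Unset Strict Implicit.
Unset Printing Implicit Defensive.

Import Order.TTheory GRing.Theory Num.Theory.
Import numFieldNormedType.Exports.

Local Open Scope classical_set_scope.
Local Open Scope ring_scope.

Section set_type_metric.
Context {R : realType} {T : metricType R} (A : set T).

Let dist (x y : A) : R := mdist (set_val x) (set_val y).

Let dist_ge0 x y : 0 <= dist x y.
Proof. exact: mdist_ge0. Qed.

Let dist_positivity x y : dist x y = 0 -> x = y.
Proof. by move=> /mdist_positivity xy; apply: val_inj; rewrite -set_valE. Qed.

Let ballEdist (x : A) d : ball x d = [set y | dist x y < d].
Proof. by rewrite /ball /= /initial_ball ballEmdist. Qed.

(* The topology and the balls of [set_type A] are already those induced by [T];
   this adds the distance itself. *)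
HB.instance Definition _ :=
  @PseudoMetric_isMetric.Build R (set_type A) dist
    dist_ge0 dist_positivity ballEdist.

End set_type_metric.

Section multiple_mappings.
Context {R : realType} {X : metricType R}.

(* [F^n(x)]: the word [s = i_1 ... i_n] acts as f_{i_1} o ... o f_{i_n}. *)
Definition iter_image m (F : m.-tuple (continuousType X X)) (n : nat) (x : X) :
    set X :=
  [set foldr (fun i y => tnth F i y) x s | s in [set: n.-tuple 'I_m]].

(* A real number, hence meaningful only for nonempty bounded sets: [sup] and
   [inf] default to 0 elsewhere. It is applied below to nonempty finite sets. *)
Definition hausdorff_dist (A B : set X) : R :=
  Num.max (sup [set inf [set mdist x y | y in B] | x in A])
          (sup [set inf [set mdist x y | x in A] | y in B]).

(* The value at [n = 0] is irrelevant to the limits below. *)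
Definition frequency (P : nat -> Prop) (n : nat) : \bar R :=
  (#|[pred i : 'I_n | `[< P i >]]|%:R / n%:R)%:E.

Definition strongly_nonwandering m (F : m.-tuple (continuousType X X)) (x : X) :
    Prop :=
  forall V : set X, open V -> V x ->
  exists y : X,
    (0%E < limn_esup (frequency (fun i => iter_image F i y `&` V !=set0)))%E.

Definition hausdorff_distributionally_chaotic m
    (F : m.-tuple (continuousType X X)) : Prop :=
  exists S : set X, ~ countable S /\
  forall x y, S x -> S y -> x <> y ->
    let close t i := hausdorff_dist (iter_image F i x) (iter_image F i y) < t in
    (forall t : R, 0 < t -> limn_esup (frequency (close t)) = 1%E) /\
    (exists2 e : R, 0 < e & limn_einf (frequency (close e)) = 0%E).

End multiple_mappings.

Definition omega_limit {T : topologicalType} (f : T -> T) (x : T) : set T :=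
  \bigcap_n closure [set iter k f x | k in [set k | (n <= k)%N]].

Lemma omega_limit_closed {T : topologicalType} (f : T -> T) (x : T) :
  closed (omega_limit f x).
Proof. by apply: closed_bigI => n _; exact: closed_closure. Qed.

Lemma omega_limit_image {T : topologicalType} (f : T -> T) (x y : T) :
  continuous f -> omega_limit f x y -> omega_limit f x (f y).
Proof.
move=> fc xy n _ B /fc/(xy n I)[_ [[k /= nk <-] Bk]].
by exists (f (iter k f x)); split => //; exists k.+1 => //=; exact: leqW.
Qed.

Lemma compact_set_type {T : topologicalType} (A : set T) :
  compact A -> compact [set: A].
Proof.
move=> cA F PF _.
have FA : (set_val @ F) A.
  by apply: (@filterS _ F _ setT) => [z _|]; [exact: set_valP|exact: filterT].
have [p [Ap Fp]] := cA _ _ FA; exists (exist _ p (mem_set Ap)); split => // B C FB.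
move=> [_ [[W oW <-]] /= Wp WC].
have [||_ [[z Bz <-] Wz]] := Fp (set_val @` B) W.
- by apply: (@filterS _ F _ B) => // z Bz; exists z.
- exact: open_nbhs_nbhs.
- by exists z; split => //; exact: WC.
Qed.

(* [R] only records where the distance takes its values. *)
Definition Sigma2 (R : realType) : Type := nat -> bool.

HB.instance Definition _ (R : realType) := Choice.copy (Sigma2 R) (nat -> bool).

Definition sigma (R : realType) (alpha : Sigma2 R) : Sigma2 R :=
  fun i => alpha i.+1.

Section sequence_space.
Context {R : realType}.
Implicit Types alpha beta gamma : Sigma2 R.

Definition rho alpha beta : R :=
  limn (series (fun i => (alpha i != beta i)%:R / 2 ^+ i : R)).

Let term alpha beta : R^nat := fun i => (alpha i != beta i)%:R / 2 ^+ i.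

Let term_ge0 alpha beta i : 0 <= term alpha beta i.
Proof. by rewrite divr_ge0. Qed.

Let geo2 : series (geometric 1 2^-1 : R^nat) @ \oo --> (2 : R).
Proof.
have h : `|2^-1 : R| < 1 by rewrite ger0_norm// invf_lt1// ltr1n.
have := @cvg_geometric_series R 1 _ h.
by rewrite (_ : 1 * _ = 2)//; field.
Qed.

Let term_le alpha beta i : term alpha beta i <= geometric 1 2^-1 i.
Proof.
rewrite /term /geometric /= mul1r exprVn ler_piMl ?invr_ge0 ?exprn_ge0//.
by case: (_ != _).
Qed.

Let is_cvg_term alpha beta : cvgn (series (term alpha beta)).
Proof.
apply: (@series_le_cvg _ _ (geometric 1 2^-1)).
- exact: term_ge0.
- by move=> i /=; rewrite mul1r exprn_ge0.
- exact: term_le.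
- by apply/cvg_ex; exists 2.
Qed.

Let rhoE alpha beta : rho alpha beta = limn (series (term alpha beta)).
Proof. by []. Qed.

Let rhoxx alpha : rho alpha alpha = 0.
Proof.
rewrite rhoE (_ : series _ = cst 0) ?lim_cst//; apply/funext => n.
by rewrite /series /= big1// => i _; rewrite /term eqxx mul0r.
Qed.

Let rho_sym alpha beta : rho alpha beta = rho beta alpha.
Proof.
rewrite !rhoE (_ : term alpha beta = term beta alpha)//.
by apply/funext => i; rewrite /term eq_sym.
Qed.

Let rho_triangle beta alpha gamma :
  rho alpha gamma <= rho alpha beta + rho beta gamma.
Proof.
rewrite !rhoE -lim_seriesD//; apply: lim_series_le => //.
  exact: is_cvg_seriesD.
move=> i; rewrite /term; change ((alpha i != gamma i)%:R / 2 ^+ i <=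
  (alpha i != beta i)%:R / 2 ^+ i + (beta i != gamma i)%:R / 2 ^+ i :> R).
rewrite -mulrDl ler_wpM2r// ?invr_ge0 ?exprn_ge0//.
by rewrite -natrD ler_nat; case: (alpha i) (beta i) (gamma i) => [] [] [].
Qed.

Let rho_ge_term alpha beta i : term alpha beta i <= rho alpha beta.
Proof.
apply: (@le_trans _ _ (series (term alpha beta) i.+1)).
  by rewrite /series /= big_nat_recr//= lerDr sumr_ge0.
rewrite rhoE; apply: nondecreasing_cvgn_le => //.
by apply: nondecreasing_series => k _ _; exact: term_ge0.
Qed.

Let rho_positivity alpha beta : rho alpha beta = 0 -> alpha = beta.
Proof.
move=> ab0; apply/funext => i; apply/eqP/negP => /negP abi.
have := rho_ge_term alpha beta i; rewrite ab0 /term abi mul1r.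
by rewrite leNgt invr_gt0 exprn_gt0.
Qed.

HB.instance Definition _ := @isMetric.Build R (Sigma2 R) rho
  rhoxx rho_positivity rho_sym rho_triangle.

Lemma rho_le2 alpha beta : rho alpha beta <= 2.
Proof.
rewrite rhoE -(cvg_lim _ geo2)//; apply: lim_series_le => //.
by apply/cvg_ex; exists 2.
Qed.

Lemma rho_sigma alpha beta :
  rho alpha beta = (alpha 0 != beta 0)%:R + rho (sigma alpha) (sigma beta) / 2.
Proof.
rewrite rhoE; apply: cvg_lim => //; rewrite -cvg_shiftS.
rewrite (_ : [sequence _]_n = fun n => (alpha 0 != beta 0)%:R +
    series (term (sigma alpha) (sigma beta)) n * 2^-1); last first.
  apply/funext => n; rewrite /series /= big_nat_recl//= {1}/term expr0 divr1.
  congr (_ + _); rewrite big_distrl /=; apply: eq_bigr => i _.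
  by rewrite /term exprS invfM [X in _ * X]mulrC mulrA.
by apply: cvgD; [exact: cvg_cst|apply: cvgMl; exact: is_cvg_term].
Qed.

Lemma mdist_sigma alpha beta :
  mdist (sigma alpha) (sigma beta) <= 2 * mdist alpha beta.
Proof.
have -> : mdist alpha beta = rho alpha beta by [].
have -> : mdist (sigma alpha) (sigma beta) = rho (sigma alpha) (sigma beta).
  by [].
rewrite (rho_sigma alpha) mulrDr mulrCA divff ?pnatr_eq0// mulr1.
by rewrite lerDr mulr_ge0.
Qed.

Lemma sigma_continuous : continuous (@sigma R).
Proof.
move=> x A /= /nbhs_ballP[e /= e0 eA]; apply/nbhs_ballP; exists (e / 2) => /=.
  by rewrite divr_gt0.
move=> y; rewrite ballEmdist /= => xy; apply: eA; rewrite ballEmdist /=.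
 apply: le_lt_trans (mdist_sigma _ _) _.
by rewrite mulrC -ltr_pdivlMr.
Qed.

Lemma rho_le_agree n alpha beta :
  (forall i, (i < n)%N -> alpha i = beta i) -> rho alpha beta <= 2 / 2 ^+ n.
Proof.
elim: n alpha beta => [|n IHn] alpha beta ab.
  by rewrite expr0 divr1 rho_le2.
rewrite rho_sigma ab// eqxx add0r exprSr invfM mulrA ler_wpM2r//.
by apply: IHn => i ni; rewrite /sigma ab.
Qed.

Lemma mdist_agree alpha (e : R) : 0 < e ->
  exists n, forall beta, (forall i, (i < n)%N -> alpha i = beta i) ->
    mdist alpha beta < e.
Proof.
move=> e0; have h : `|2^-1 : R| < 1 by rewrite ger0_norm// invf_lt1// ltr1n.
have /cvgrPdist_lt /(_ e e0) [n _ /(_ n (leqnn n))] :=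
  @cvg_geometric R 2 _ h.
rewrite sub0r normrN /= exprVn => ne.
exists n => beta /rho_le_agree abn.
by apply: le_lt_trans ne; rewrite ger0_norm ?divr_ge0 ?exprn_ge0//.
Qed.

Lemma Sigma2_compact : compact [set: Sigma2 R].
Proof.
pose f (x : cantor_space) : Sigma2 R := x.
have -> : [set: Sigma2 R] = f @` [set: cantor_space].
  by apply/seteqP; split => // x _; exists x.
apply: continuous_compact cantor_space_compact.
apply: continuous_subspaceT => x; apply/cvg_ballP => e e0.
have [n xe] := mdist_agree (f x) e0.
have H : \forall y \near nbhs (x : cantor_space), forall i, (i < n)%N -> x i = y i.
  elim: n {xe} => [|n IHn]; first exact: nearW.
  have Hn : \forall y \near nbhs (x : cantor_space), x n = y n.
    have := @proj_continuous _ (fun=> bool) n x [set b | x n = b].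
    by apply; apply: (@open_nbhs_nbhs bool); split => //; exact: discrete_open.
  apply: filterS2 IHn Hn => y xyn xy i.
  by rewrite ltnS leq_eqVlt => /predU1P[->|/xyn].
by apply: filterS H => y /xe; rewrite ballEmdist.
Qed.

End sequence_space.

(* [word n] is A_{n+1}. *)
Fixpoint word (n : nat) : seq bool :=
  if n is m.+1 then
    let w := word m in
    w ++ nseq (size w) false ++ w ++ nseq (size w) true ++ w
  else [:: true; false; true; true; true].

Lemma size_word n : size (word n) = (5 ^ n.+1)%N.
Proof.
elim: n => [//|n IHn]; rewrite [word _]/= !size_cat !size_nseq IHn.
by rewrite [RHS]expnS; lia.
Qed.

Lemma ltn_size_word n : (n < size (word n))%N.
Proof. by rewrite size_word; apply: (ltn_trans (ltnSn n)); exact: ltn_expl. Qed.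

Lemma nth_word m n i : (m <= n)%N -> (i < size (word m))%N ->
  nth false (word n) i = nth false (word m) i.
Proof.
move=> /subnK <-; elim: (n - m)%N => [//|k IHk] im.
rewrite addSn [word _]/= nth_cat ifT ?IHk//; apply: leq_trans im _.
by rewrite !size_word leq_exp2l// ltnS leq_addl.
Qed.

Section system.
Context (R : realType).

Definition seq_u : Sigma2 R := fun i => nth false (word i) i.

Lemma seq_u_prefix n : mkseq seq_u (size (word n)) = word n.
Proof.
apply: (@eq_from_nth _ false); rewrite size_mkseq// => i iw.
rewrite nth_mkseq// /seq_u; have [ni|/ltnW ni] := leqP n i.
  by rewrite (nth_word ni).
by rewrite (nth_word ni) ?ltn_size_word.
Qed.

Lemma seq_u_unique (v : Sigma2 R) :
  (forall n, mkseq v (size (word n)) = word n) -> v = seq_u.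
Proof.
move=> vp; apply/funext => i; rewrite /seq_u -(vp i) nth_mkseq//.
exact: ltn_size_word.
Qed.

Definition omega_u : set (Sigma2 R) := omega_limit (@sigma R) seq_u.

Lemma compact_omega_u : compact [set: omega_u].
Proof.
apply: compact_set_type; apply: subclosed_compact (@Sigma2_compact R) _ => //.
exact: omega_limit_closed.
Qed.

Lemma iter_sigma k (alpha : Sigma2 R) i :
  iter k (@sigma R) alpha i = alpha (k + i)%N.
Proof. by elim: k i => [//|k IHk] i; rewrite iterS /sigma IHk addnS. Qed.

(* Constant blocks of every length occur in [seq_u] arbitrarily far. *)
Let constant_mem_omega_u (c : bool) :
  (forall n i, (i < size (word n))%N ->
    seq_u ((if c then 3 * size (word n) else size (word n)) + i)%N = c) ->
  omega_u (fun=> c).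
Proof.
move=> uc n _ B /nbhs_ballP[e /= e0 eB].
have [m em] := mdist_agree ((fun=> c) : Sigma2 R) e0.
pose l := maxn m n.
exists (iter (if c then 3 * size (word l) else size (word l))%N (@sigma R) seq_u).
have lw := ltn_size_word l.
split.
  eexists; last reflexivity; rewrite /= /l in lw *.
  by case: c {uc eB em}; lia.
apply: eB; rewrite ballEmdist /=; apply: em => i im.
by rewrite iter_sigma uc//; rewrite /l in lw *; lia.
Qed.

Let nth_u_word n i : (i < size (word n))%N -> seq_u i = nth false (word n) i.
Proof. by move=> iw; rewrite -{1}(seq_u_prefix n) nth_mkseq. Qed.

Lemma zeros_mem_omega_u : omega_u (fun=> false).
Proof.
apply: constant_mem_omega_u => n i iw; rewrite (@nth_u_word n.+1); last first.
  by rewrite /= !size_cat !size_nseq; lia.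
rewrite /= nth_cat ifF; last by lia.
by rewrite addKn nth_cat size_nseq iw nth_nseq iw.
Qed.

Lemma ones_mem_omega_u : omega_u (fun=> true).
Proof.
apply: constant_mem_omega_u => n i iw; rewrite (@nth_u_word n.+1); last first.
  by rewrite /= !size_cat !size_nseq; lia.
rewrite /= nth_cat ifF; last by lia.
rewrite nth_cat size_nseq ifF; last by lia.
rewrite nth_cat ifF; last by lia.
rewrite nth_cat size_nseq ifT; last by lia.
by rewrite nth_nseq ifT//; lia.
Qed.

Definition pt_a : omega_u := exist _ (fun=> false) (mem_set zeros_mem_omega_u).

Definition pt_b : omega_u := exist _ (fun=> true) (mem_set ones_mem_omega_u).

Definition sigma_u (x : omega_u) : omega_u :=
  exist _ (sigma (set_val x))
    (mem_set (omega_limit_image (@sigma_continuous R) (set_valP x))).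

Lemma sigma_u_continuous : continuous sigma_u.
Proof.
apply: (@continuous_comp_initial _ _ _ (@set_val _ omega_u)) => x.
rewrite (_ : set_val \o sigma_u = @sigma R \o set_val)//.
apply: continuous_comp; first exact: initial_continuous.
exact: sigma_continuous.
Qed.

HB.instance Definition _ :=
  @isContinuous.Build omega_u omega_u sigma_u sigma_u_continuous.

(* The tuple {sigma, f_0}. *)
Definition F_u : 2.-tuple (continuousType omega_u omega_u) :=
  [tuple (sigma_u : continuousType omega_u omega_u);
         (cst pt_a : continuousType omega_u omega_u)].

End system.

(* Main.v *)
Require Import Defs.
From mathcomp Require Import all_boot all_order all_algebra.
From mathcomp Require Import all_classical all_reals all_analysis.
From mathcomp Require Import zify ring lra.

(** Read in base 5, the letter of [u] at position [i] is governed by the most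
significant odd digit of [i]: it is 0 if that digit is 1, and 1 if that digit
is 3 or if there is no odd digit ([seq_u_top_digit]).  So [u] is made of
constant blocks on all scales, and both halves of the theorem come from this.

Strongly nonwandering points.  A window of [u] of length [5^m] aligned on a
multiple of [5^m] contains fewer than [2 * 3^m] changes of letter, because two
of the five sub-blocks of each block are constant ([changes_block]).  Hence the
changes of letter have density zero in [u], uniformly in the window
([rare_changes]), and so in every point of [X], whose finite subwords are
subwords of [u].  Since [F^i(y)] is the pair of [sigma^i(y)] and [a] for
[0 < i] ([iter_imageE]), the neighbourhood of the points whose letters at [k]
and [k+1] differ is visited with density zero by every [y].  A point of [X]
other than [a] and [b] has such a neighbourhood, while [a] and [b] are fixed by
[sigma] and visit each of their neighbourhoods all the time.

Chaos.  A 0-1 sequence [c] is turned into a point of [X] that is constant, equal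
to [c j], between times [delay c j] and [scale j] ([coded_seq_block]), where
[delay c j] is negligible with respect to [scale j] ([delay_negligible]).  It is
the limit of the final segments of length [delay c j] of the prefixes
of [u] of length [scale j] (an element of the base 5 odometer whose digits are
all 4 but for a sparse set of digits 0 and 2, which record [c]).  If
[c] and [c'] agree infinitely often, then along the corresponding times [scale j]
the two orbits are close for a proportion of time tending to 1; if they differ
infinitely often, then for a proportion of time tending to 1 one orbit begins
with 1 and the other one with 0, so that the sets [F^i(x)] and [F^i(y)] are at
distance at least 1.  The sequences [code alpha] are pairwise in both
situations, and there are uncountably many of them. *)

Set Implicit Arguments.
Unset Strict Implicit.
Unset Printing Implicit Defensive.

Import Order.TTheory GRing.Theory Num.Theory.
Import numFieldNormedType.Exports.

Local Open Scope classical_set_scope.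

(** * The base 5 structure of [u] *)

Lemma seq_u_word (R : realType) n i : (i < size (word n))%N ->
  seq_u R i = nth false (word n) i.
Proof. by move=> iw; rewrite -[in RHS](seq_u_prefix R n) nth_mkseq. Qed.

(** This is [A_{n+1} = A_n O_n A_n I_n A_n] read letter by letter; it also
holds at [n = 0], with the one-letter word 1 in the role of [A_0]. *)
Lemma seq_u_top_digit (R : realType) n d i : (d < 5)%N -> (i < 5 ^ n)%N ->
  seq_u R (d * 5 ^ n + i)%N = if odd d then d == 3 else seq_u R i.
Proof.
move=> d5; case: n => [|n].
  rewrite expn0 ltnS leqn0 => /eqP ->; rewrite muln1 addn0.
  by case: d d5 => [|[|[|[|[|]]]]].
rewrite -size_word => iw.
rewrite (@seq_u_word _ n.+1); last first.
  rewrite /= !size_cat !size_nseq; nia.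
rewrite (seq_u_word R iw) /=.
case: d d5 => [|[|[|[|[|//]]]]] _ /=; rewrite !nth_cat !size_nseq.
- by rewrite mul0n add0n iw.
- by rewrite ifF; [rewrite mul1n addKn iw nth_nseq iw|lia].
- rewrite ifF; last by lia.
  rewrite ifF; last by lia.
  rewrite ifT; last by lia.
  congr nth; lia.
- rewrite ifF; last by lia.
  rewrite ifF; last by lia.
  rewrite ifF; last by lia.
  rewrite ifT; last by lia.
  by rewrite nth_nseq ifT//; lia.
- rewrite ifF; last by lia.
  rewrite ifF; last by lia.
  rewrite ifF; last by lia.
  rewrite ifF; last by lia.
  congr nth; lia.
Qed.

(** The least digit of [j] is an odd digit of every position in the block, so
the most significant odd digit of such a position lies at or above it and is
common to the whole block.  The proof strips the top digits one at a time. *)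
Lemma seq_u_odd_block (R : realType) m j i : odd (j %% 5) -> (i < 5 ^ m)%N ->
  seq_u R (j * 5 ^ m + i)%N = seq_u R (j * 5 ^ m)%N.
Proof.
(* [N] bounds the number of base 5 digits of the positions in the block. *)
suff H N : (j.+1 * 5 ^ m <= 5 ^ N)%N -> odd (j %% 5) -> (i < 5 ^ m)%N ->
    seq_u R (j * 5 ^ m + i)%N = seq_u R (j * 5 ^ m)%N.
  apply: (H (j.+1 + m)%N); rewrite expnD leq_mul2r; apply/orP; right.
  by apply/ltnW; exact: ltn_expl.
elim: N m j i => [|N IHN] m j i jm oj im.
  have j0 : j = 0%N by move: jm im; rewrite expn0; nia.
  by rewrite j0 in oj.
have [mN|Nm|mN] := ltngtP m N.
- have dvd5 : (5 %| 5 ^ (N - m))%N by rewrite dvdn_exp// subn_gt0.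
  have eN : (5 ^ N = 5 ^ (N - m) * 5 ^ m)%N by rewrite -expnD subnK// ltnW.
  have jE := divn_eq j (5 ^ (N - m)).
  have j'lt : (j %% 5 ^ (N - m) < 5 ^ (N - m))%N by rewrite ltn_mod expn_gt0.
  have j'5 : (j %% 5 ^ (N - m) %% 5 = j %% 5)%N by rewrite modn_dvdm.
  move: (j %/ _)%N (j %% _)%N jE j'lt j'5 => d j' jE j'lt j'5.
  have j'N : (j'.+1 * 5 ^ m <= 5 ^ N)%N by rewrite eN leq_mul2r j'lt orbT.
  have d5 : (d < 5)%N.
    by move: jm; rewrite jE expnS eN; have := expn_gt0 5 m; nia.
  have E k : (j * 5 ^ m + k = d * 5 ^ N + (j' * 5 ^ m + k))%N.
    by rewrite jE eN; ring.
  have bnd k : (k < 5 ^ m)%N -> (j' * 5 ^ m + k < 5 ^ N)%N.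
    by move: j'N; rewrite mulSn; lia.
  rewrite E -[(j * 5 ^ m)%N]addn0 E !(@seq_u_top_digit R N d) ?bnd ?expn_gt0//.
  by case: ifP => // _; rewrite addn0 IHN// j'5.
(* A block at least as long as the whole range has [j = 0], which is even. *)
- have [Nm1|] := ltnP N.+1 m.
    by move: jm; rewrite leqNgt (leq_trans _ (leq_pmull _ _))// ltn_exp2l.
  move=> mN; have mE : m = N.+1 by lia.
  have j0 : j = 0%N by move: jm im; rewrite mE; nia.
  by rewrite j0 in oj.
- have j5 : (j < 5)%N by move: jm; rewrite mN expnS leq_pmul2r ?expn_gt0.
  rewrite mN in im *; rewrite -{2}[(j * 5 ^ N)%N]addn0 !seq_u_top_digit//.
    by move: oj; rewrite modn_small// => ->.
  by rewrite expn_gt0.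
Qed.

Definition change (v : nat -> bool) (i : nat) : bool := v i != v i.+1.

(** The letters of the block are equal, so only its last position, compared with
the first one of the next block, can be a change. *)
Lemma changes_odd_block (R : realType) m j : odd (j %% 5) ->
  (\sum_(j * 5 ^ m <= i < j.+1 * 5 ^ m) change (seq_u R) i <= 1)%N.
Proof.
move=> oj; have [k kE] : exists k, (5 ^ m = k.+1)%N.
  by exists (5 ^ m).-1; rewrite prednK ?expn_gt0.
rewrite (_ : j.+1 * 5 ^ m = (j * 5 ^ m + k).+1)%N; last by rewrite mulSn; lia.
rewrite big_nat_recr ?leq_addr//= big_nat big1; first by case: change.
move=> i /andP[/subnKC <-]; rewrite ltn_add2l => ik.
by rewrite /change -addnS !(@seq_u_odd_block _ m j) ?eqxx//; lia.
Qed.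

(** If [b_m] is the maximal number of changes, then the five sub-blocks give
[b_(m+1) <= 3 * b_m + 2], two of them being constant; so [b_m < 2 * 3^m]. *)
Lemma changes_block (R : realType) m j :
  (\sum_(j * 5 ^ m <= i < j.+1 * 5 ^ m) change (seq_u R) i < 2 * 3 ^ m)%N.
Proof.
elim: m j => [|m IHm] j.
  by rewrite !expn0 !muln1 big_nat1; case: change.
(* [S r] counts the changes in the sub-block of index [5 * j + r]. *)
pose S r := (\sum_((5 * j + r) * 5 ^ m <= i < (5 * j + r.+1) * 5 ^ m)
  change (seq_u R) i)%N.
have any r : (S r < 2 * 3 ^ m)%N by rewrite /S addnS.
have odd_sub r : (r < 5)%N -> odd r -> (S r <= 1)%N.
  move=> r5 ro; rewrite /S addnS changes_odd_block//.
  by rewrite mulnC modnMDl modn_small.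
have cut r : (\sum_(5 * j * 5 ^ m <= i < (5 * j + r.+1) * 5 ^ m)
    change (seq_u R) i = \sum_(5 * j * 5 ^ m <= i < (5 * j + r) * 5 ^ m)
    change (seq_u R) i + S r)%N.
  by rewrite -big_cat_nat//= leq_mul2r ?leq_addr ?addnS ?leqnSn orbT.
rewrite (_ : j * 5 ^ m.+1 = 5 * j * 5 ^ m)%N; last by rewrite expnS; ring.
rewrite (_ : j.+1 * 5 ^ m.+1 = (5 * j + 5) * 5 ^ m)%N; last by rewrite expnS; lia.
rewrite !cut addn0 big_geq// expnS.
have := any 0%N; have := any 2; have := any 4.
have := odd_sub 1%N isT isT; have := odd_sub 3 isT isT; lia.
Qed.

(** A window of length [n] is covered by [n %/ 5^m + 2] aligned blocks. *)
Lemma changes_window (R : realType) m q n :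
  (\sum_(q <= i < q + n) change (seq_u R) i <= (n %/ 5 ^ m + 2) * (2 * 3 ^ m))%N.
Proof.
set L := (5 ^ m)%N; have L0 : (0 < L)%N by rewrite expn_gt0.
have cover k j : (\sum_(j * L <= i < (j + k) * L) change (seq_u R) i
    <= k * (2 * 3 ^ m))%N.
  elim: k => [|k IHk]; first by rewrite addn0 big_geq.
  rewrite addnS (@big_cat_nat _ _ _ ((j + k) * L)) ?leq_mul2r ?leq_addr ?orbT//=;
    last by rewrite leqnSn orbT.
  rewrite [leqRHS]mulSnr leq_add//; exact: ltnW (changes_block R m (j + k)).
apply: leq_trans (cover _ (q %/ L)%N).
have qL := leq_divM q L; have qL' := ltn_ceil q L0; have nL' := ltn_ceil n L0.
have qn : (q + n <= (q %/ L + (n %/ L + 2)) * L)%N by lia.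
rewrite [leqRHS](@big_cat_nat _ _ _ q)//=; last by lia.
rewrite [X in (_ <= _ + X)%N](@big_cat_nat _ _ _ (q + n))//=; lia.
Qed.

(** The ratio [2 * 3^m / 5^m] of the bound on the changes to the length of a block
tends to zero; Bernoulli's inequality for [5/3] makes this effective. *)
Lemma rare_changes (R : realType) K : exists N, forall n q, (N <= n)%N ->
  (K * \sum_(q <= i < q + n) change (seq_u R) i <= n)%N.
Proof.
have growth m : ((3 + 2 * m) * 3 ^ m <= 3 * 5 ^ m)%N.
  by elim: m => [//|m IHm]; rewrite !expnS; nia.
(* With this [m], [4 * K * 3^m <= 5^m]: the complete blocks contribute at most
   [n / 2], and so do the two extra ones when [n] is at least [8 * K * 3^m]. *)
pose m := (6 * K)%N; exists (8 * K * 3 ^ m)%N => n q nN.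
have := growth m; have := @changes_window R m q n; have := leq_divM n (5 ^ m).
rewrite /m; move: (\sum_(_ <= i < _) _)%N (5 ^ _)%N (3 ^ _)%N (n %/ _)%N nN.
rewrite -/m => S P Q D nN DP SD QP.
have QP' : (4 * K * Q <= P)%N by rewrite /m in QP; nia.
have : (2 * (K * S) <= D * (4 * K * Q) + 8 * K * Q)%N by nia.
have : (D * (4 * K * Q) <= D * P)%N by rewrite leq_mul2l QP' orbT.
by lia.
Qed.

(** * Upper and lower densities *)

(** The numerator of [frequency]: limits of frequencies are reduced below to
integer inequalities of the form [K * hits P n <= n]. *)
Definition hits (P : nat -> Prop) (n : nat) : nat :=
  #|[pred i : 'I_n | `[< P i >]]|.

Lemma hits_sum P n : hits P n = (\sum_(0 <= i < n) `[< P i >])%N.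
Proof.
rewrite big_mkord /hits -sum1_card big_mkcond /=.
by apply: eq_bigr => i _; rewrite unfold_in /=; case: asbool.
Qed.

Lemma hits_not P n : (hits P n + hits (fun i => ~ P i) n = n)%N.
Proof.
rewrite !hits_sum -big_split /= (eq_big_nat _ _ (F2 := fun=> 1%N)).
  by rewrite sum_nat_const_nat muln1 subn0.
by move=> i _; rewrite asbool_neg; case: asboolP.
Qed.

Lemma hits_le_window (P : nat -> Prop) n a b :
  (forall i, (i < n)%N -> P i -> (i < a)%N \/ (n <= i + b)%N) ->
  (hits P n <= a + b)%N.
Proof.
move=> Pab; rewrite hits_sum.
have [nab|abn] := leqP n (a + b).
  apply: leq_trans nab; rewrite -[leqRHS]muln1 -[in leqRHS](subn0 n).
  by rewrite -sum_nat_const_nat leq_sum// => i _; case: asboolP.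
rewrite (@big_cat_nat _ _ _ a)//=; last by lia.
rewrite (@big_cat_nat _ _ _ (n - b) a)//=; [|by lia|by lia].
have -> : (\sum_(a <= i < n - b) `[< P i >] = 0)%N.
  rewrite big_nat big1// => i /andP[ai ib]; case: asboolP => // Pi.
  by case: (Pab i _ Pi); lia.
have sum_le c d : (\sum_(c <= i < d) `[< P i >] <= d - c)%N.
  rewrite -[leqRHS]muln1 -sum_nat_const_nat leq_sum// => i _.
  by case: asboolP.
have := sum_le 0%N a; have := sum_le (n - b)%N n; lia.
Qed.

Local Open Scope ring_scope.

Lemma frequencyE (R : realType) P n :
  frequency P n = ((hits P n)%:R / n%:R : R)%:E.
Proof. by []. Qed.

Lemma frequency_ge0 (R : realType) P n : (0 <= frequency P n :> \bar R)%E.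
Proof. by rewrite lee_fin divr_ge0. Qed.

Lemma frequency_le1 (R : realType) P n : (frequency P n <= 1 :> \bar R)%E.
Proof.
rewrite frequencyE lee_fin; case: n => [|n]; first by rewrite invr0 mulr0.
rewrite ler_pdivrMr ?ltr0n// mul1r ler_nat -[leqRHS](hits_not P).
exact: leq_addr.
Qed.

Lemma frequency_not (R : realType) P n : (0 < n)%N ->
  frequency P n = (1 - frequency (fun i => ~ P i) n :> \bar R)%E.
Proof.
move=> n0; rewrite !frequencyE -EFinB; congr EFin.
have nR : n%:R != 0 :> R by rewrite pnatr_eq0 -lt0n.
have E : (hits P n)%:R = n%:R - (hits (fun i => ~ P i) n)%:R :> R.
  by rewrite -[in n%:R](hits_not P n) natrD addrK.
by rewrite E mulrBl divff.
Qed.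

Lemma frequency_le_inv (R : realType) P n K : (0 < n)%N ->
  (K.+1 * hits P n <= n)%N -> (frequency P n <= (K.+1%:R^-1 : R)%:E)%E.
Proof.
move=> n0 Kn; rewrite frequencyE lee_fin ler_pdivrMr ?ltr0n//.
by rewrite ler_pdivlMl ?ltr0n// -natrM ler_nat.
Qed.

Lemma limn_esup_le (R : realType) (v : (\bar R)^nat) N l :
  (forall n, (N <= n)%N -> (v n <= l)%E) -> (limn_esup v <= l)%E.
Proof.
move=> vl; apply: (@le_trans _ _ (ereal_sup (v @` [set n | (N <= n)%N]))).
  by apply: ereal_inf_lbound; exists [set n | (N <= n)%N] => //; exists N.
by apply: ge_ereal_sup => _ [n /= Nn <-]; exact: vl.
Qed.

Lemma limn_esup_ge (R : realType) (v : (\bar R)^nat) l :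
  (forall N, exists2 n, (N <= n)%N & (l <= v n)%E) -> (l <= limn_esup v)%E.
Proof.
move=> lv; apply: le_ereal_inf_tmp => _ [V [N _ NV] <-].
have [n Nn ln] := lv N; apply: le_trans ln _.
by apply: ereal_sup_ubound; exists n => //; exact: NV.
Qed.

Lemma limn_esup_frequency_eq0 (R : realType) (P : nat -> Prop) :
  (forall K, exists N, forall n, (N <= n)%N -> (K * hits P n <= n)%N) ->
  limn_esup (frequency P) = 0%E :> \bar R.
Proof.
move=> PK; apply/eqP; rewrite eq_le; apply/andP; split; last first.
  by apply: limn_esup_ge => N; exists N => //; exact: frequency_ge0.
apply/lee_addgt0Pr => e e0; rewrite add0e.
have [K Ke] := ltr_add_invr e0; rewrite add0r in Ke.
have [N PN] := PK K.+1; apply: (@limn_esup_le _ _ N.+1) => n Nn.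
apply: le_trans (frequency_le_inv R _ (PN _ (ltnW Nn))) _; first by lia.
by rewrite lee_fin ltW.
Qed.

Lemma limn_esup_frequency_eq1 (R : realType) (P : nat -> Prop) :
  (forall K N, exists n, [/\ (N <= n)%N, (0 < n)%N &
    (K * hits (fun i => ~ P i) n <= n)%N]) ->
  limn_esup (frequency P) = 1%E :> \bar R.
Proof.
move=> PK; apply/eqP; rewrite eq_le; apply/andP; split.
  by apply: (@limn_esup_le _ _ 0) => n _; exact: frequency_le1.
apply/lee_subgt0Pr => e e0; apply: limn_esup_ge => N.
have [K Ke] := ltr_add_invr e0; rewrite add0r in Ke.
have [n [Nn n0 Kn]] := PK K.+1 N; exists n => //.
rewrite frequency_not//; apply: leeB => //.
by apply: le_trans (frequency_le_inv R _ Kn) _ => //; rewrite lee_fin ltW.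
Qed.

Lemma limn_einf_frequency_eq0 (R : realType) (P : nat -> Prop) :
  (forall K N, exists n, [/\ (N <= n)%N, (0 < n)%N & (K * hits P n <= n)%N]) ->
  limn_einf (frequency P) = 0%E :> \bar R.
Proof.
move=> PK; apply/eqP; rewrite /limn_einf oppe_eq0 eq_le; apply/andP; split.
  by apply: (@limn_esup_le _ _ 0) => n _; rewrite leeNl oppe0 frequency_ge0.
apply/lee_subgt0Pr => e e0; apply: limn_esup_ge => N.
have [K Ke] := ltr_add_invr e0; rewrite add0r in Ke.
have [n [Nn n0 Kn]] := PK K.+1 N; exists n => //.
rewrite sub0e leeN2.
by apply: le_trans (frequency_le_inv R _ Kn) _ => //; rewrite lee_fin ltW.
Qed.

(** Converse of [rho_le_agree]: a point that is close enough to another one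
shares its first letters. *)
Lemma rho_disagree (R : realType) i (alpha beta : Sigma2 R) :
  alpha i != beta i -> (2 ^+ i)^-1 <= mdist alpha beta.
Proof.
change (mdist alpha beta) with (rho alpha beta).
have rho_ge0 (x y : Sigma2 R) : 0 <= rho x y by exact: (mdist_ge0 x y).
elim: i alpha beta => [|i IHi] alpha beta ab; rewrite rho_sigma.
  by rewrite ab expr0 invr1 lerDl divr_ge0.
rewrite exprSr invfM.
rewrite ler_wpDl// ler_pM2r ?invr_gt0//; exact: IHi.
Qed.

(** A point is in [X] if and only if its prefixes occur arbitrarily far in [u]. *)
Lemma omega_uP (R : realType) (x : Sigma2 R) : omega_u x <->
  forall n m, exists2 k, (n <= k)%N &
    forall i, (i < m)%N -> seq_u R (k + i)%N = x i.
Proof.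
split=> [xu n m|xu n _ B /nbhs_ballP[e /= e0 eB]].
  have [_ [[k /= nk <-] kx]] := xu n I _ (nbhsx_ballx x (2 ^+ m)^-1
    ltac:(by rewrite invr_gt0 exprn_gt0)).
  rewrite ballEmdist /= in kx.
  exists k => // i im; apply/esym/eqP; apply: contraTT kx => xk.
  rewrite -iter_sigma in xk; rewrite -leNgt; apply: le_trans (rho_disagree xk).
  by rewrite lef_pV2 ?posrE ?exprn_gt0// ler_weXn2l ?ler1n// ltnW.
have [m xm] := mdist_agree x e0.
have [k nk kx] := xu n m; exists (iter k (@sigma R) (seq_u R)).
split; first by exists k.
by apply: eB; rewrite ballEmdist /=; apply: xm => i im; rewrite iter_sigma kx.
Qed.

(** * Iterated images and the Hausdorff distance *)

Lemma iter_sigma_uE (R : realType) n (x : @omega_u R) i :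
  set_val (iter n (@sigma_u R) x) i = set_val x (n + i)%N.
Proof. by elim: n i => [//|n IHn] i; rewrite iterS [LHS]IHn addnS. Qed.

Lemma sigma_u_pt_a (R : realType) : sigma_u (pt_a R) = pt_a R.
Proof. exact: val_inj. Qed.

Lemma sigma_u_pt_b (R : realType) : sigma_u (pt_b R) = pt_b R.
Proof. exact: val_inj. Qed.

Lemma iter_image_orbit (R : realType) n (x : @omega_u R) :
  iter_image (F_u R) n x (iter n (@sigma_u R) x).
Proof.
exists (nseq_tuple n ord0) => //=.
by elim: n => [//|n IHn] /=; rewrite IHn.
Qed.

Lemma iter_image_pt_a (R : realType) n (x : @omega_u R) :
  (0 < n)%N -> iter_image (F_u R) n x (pt_a R).
Proof. by case: n => [//|n] _; exists (cons_tuple ord_max (nseq_tuple n ord0)). Qed.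

Lemma iter_image_sub (R : realType) n (x : @omega_u R) :
  iter_image (F_u R) n x `<=` [set iter n (@sigma_u R) x; pt_a R].
Proof.
move=> _ [[s /= /eqP <-] _ <-]; elim: s => [|i t IHt] /=.
  by left.
case: i => [[|[|//]] ilt] /=; last by right.
rewrite /tnth /=.
by case: IHt => ->; [left|right; exact: sigma_u_pt_a].
Qed.

(** Both maps fix [a], and [f_0] sends everything to [a]: a composition that
involves [f_0] is the constant [a].  At [n = 0] only the first point remains. *)
Lemma iter_imageE (R : realType) n (x : @omega_u R) : (0 < n)%N ->
  iter_image (F_u R) n x = [set iter n (@sigma_u R) x; pt_a R].
Proof.
move=> n0; apply/seteqP; split; first exact: iter_image_sub.
by move=> _ [->|->]; [exact: iter_image_orbit|exact: iter_image_pt_a].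
Qed.

Lemma sup_pair (R : realType) (x y : R) : sup [set x; y] = Num.max x y.
Proof.
wlog xy : x y / x <= y.
  move=> H; case: (leP x y) => [xy|/ltW yx]; first by rewrite H// max_r.
  by rewrite setUC H// max_r.
rewrite (sup_setU (has_sup1 y)) ?sup1 ?max_r//.
by move=> _ _ -> ->.
Qed.

Lemma inf_pair (R : realType) (x y : R) : inf [set x; y] = Num.min x y.
Proof.
wlog xy : x y / x <= y.
  move=> H; case: (leP x y) => [xy|/ltW yx]; first by rewrite H// min_l.
  by rewrite setUC H// min_l.
rewrite (inf_setU (has_inf1 x)) ?inf1 ?min_l//.
by move=> _ _ -> ->.
Qed.

(** The common point [a] is at distance 0 from the other pair, so that only [p] and
[q] count in the suprema. *)
Lemma hausdorff_dist_pair (R : realType) (X : metricType R) (p q a : X) :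
  hausdorff_dist [set p; a] [set q; a] =
  Num.max (Num.min (mdist p q) (mdist p a)) (Num.min (mdist p q) (mdist a q)).
Proof.
rewrite /hausdorff_dist !image_setU !image_set1 !sup_pair.
rewrite !image_setU !image_set1 !inf_pair mdistxx.
by rewrite !(min_r (mdist_ge0 _ _)) ![Num.max _ 0]max_l ?le_min ?mdist_ge0.
Qed.

(** * Strongly nonwandering points *)

Lemma fixed_strongly_nonwandering (R : realType) (x : @omega_u R) :
  sigma_u x = x -> strongly_nonwandering (F_u R) x.
Proof.
move=> fx V oV Vx; exists x.
rewrite limn_esup_frequency_eq1 ?lte01// => K N; exists N.+1; split => //.
rewrite (_ : hits _ _ = 0)%N ?muln0//; apply/eqP; rewrite -leqn0.
rewrite -[0%N]/(0 + 0)%N; apply: hits_le_window => i _ /=; case.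
exists x; split => //; rewrite -[X in iter_image _ _ _ X](iter_fix i fx).
exact: iter_image_orbit.
Qed.

Lemma change_constant (v : nat -> bool) :
  (forall k, ~~ change v k) -> v = fun=> v 0%N.
Proof.
move=> vc; apply/funext; elim => [//|k <-].
by have := vc k; rewrite /change negbK => /eqP.
Qed.

Lemma sum_window (f : nat -> nat) q n :
  (\sum_(q <= i < q + n) f i = \sum_(i < n) f (q + i)%N)%N.
Proof.
rewrite -{1}[q]add0n big_addn addKn big_mkord.
by apply: eq_bigr => i _; rewrite addnC.
Qed.

(** Every finite subword of a point of [X] is a subword of [u]. *)
Lemma rare_changes_omega_u (R : realType) K : exists N, forall n q (y : @omega_u R),
  (N <= n)%N -> (K * \sum_(q <= i < q + n) change (set_val y) i <= n)%N.
Proof.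
have [N uN] := rare_changes R K; exists N => n q y Nn.
have /omega_uP/(_ 0%N (q + n).+1)[k _] := set_valP y; rewrite -set_valE => ky.
apply: leq_trans (uN n (k + q)%N Nn); rewrite leq_mul2l; apply/orP; right.
rewrite !sum_window leq_sum// => i _; rewrite /change -!ky ?addnS ?addnA//.
  by have := ltn_ord i; lia.
by have := ltn_ord i; lia.
Qed.

Lemma open_change (R : realType) k :
  open [set z : @omega_u R | change (set_val z) k].
Proof.
rewrite openE => z zk; apply/nbhs_ballP; exists ((2 ^+ k.+1)^-1).
  by rewrite /= invr_gt0 exprn_gt0.
move=> y; rewrite ballEmdist /= => zy.
have agree i : (i <= k.+1)%N -> set_val y i = set_val z i.
  move=> ik; apply/esym/eqP; apply: contraTT zy => zyi.
  rewrite -leNgt; apply: le_trans (rho_disagree zyi).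
  by rewrite lef_pV2 ?posrE ?exprn_gt0// ler_weXn2l ?ler1n.
by rewrite /change !agree.
Qed.

(** A nonconstant [x] has a change of letter at some [k].  The set of the points
having a change at [k] is an open neighbourhood of [x] that does not contain [a],
so [y] visits it at time [i] only if [y] has a change at [k + i]. *)
Lemma strongly_nonwandering_fixed (R : realType) (x : @omega_u R) :
  strongly_nonwandering (F_u R) x -> x = pt_a R \/ x = pt_b R.
Proof.
move=> xs; have [[k xk]|nk] := pselect (exists k, change (set_val x) k).
  have [y] := xs _ (open_change R k) xk.
  rewrite limn_esup_frequency_eq0 ?ltxx// => K.
  have [N yN] := rare_changes_omega_u R K; exists N => n Nn.
  apply: leq_trans (yN n k y Nn); rewrite leq_mul2l; apply/orP; right.
  rewrite hits_sum sum_window big_mkord leq_sum// => i _.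
  case: asboolP => // -[z [/iter_image_sub[->|->]]] /=.
    by rewrite /change !iter_sigma_uE addnS [(i + k)%N]addnC => ->.
  by rewrite /change eqxx.
have xc : forall k, ~~ change (set_val x) k.
  by move=> k; apply/negP => xk; apply: nk; exists k.
have := change_constant xc; case: (set_val x 0%N) => E; [right|left].
  exact: val_inj.
exact: val_inj.
Qed.

(** * Points of [X] with prescribed letters on long intervals *)

(** Each [A_n] is a suffix of the following one. *)
Lemma seq_u_suffix (R : realType) n k t : (0 < t <= 5 ^ n)%N ->
  seq_u R (5 ^ (n + k) - t)%N = seq_u R (5 ^ n - t)%N.
Proof.
move=> /andP[t0 tn]; elim: k => [|k IHk]; first by rewrite addn0.
have nk : (5 ^ n <= 5 ^ (n + k))%N by rewrite leq_exp2l// leq_addr.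
rewrite -IHk addnS expnS.
rewrite (_ : 5 * 5 ^ (n + k) - t = 4 * 5 ^ (n + k) + (5 ^ (n + k) - t))%N.
  by rewrite seq_u_top_digit//; lia.
by lia.
Qed.

(** The exponents [j * j] have unbounded gaps; this makes [delay c j] small with
respect to [scale j]. *)
Definition scale (j : nat) : nat := (5 ^ (j * j))%N.

(** The length [t] of a suffix of the prefix of [u] of length [L = scale j].  Placing
the suffix in the block of digit [d] of [A O A I A] and going on to the end of the
five blocks leads to a suffix of length [t + (4 - d) * L].  With [d = 2] the next
block is I, with [d = 0] it is O. *)
Fixpoint delay (c : nat -> bool) (j : nat) : nat :=
  if j is k.+1 then (delay c k + (if c k then 2 else 4) * scale k)%N else 1%N.

Lemma scale_gt0 j : (0 < scale j)%N.
Proof. by rewrite expn_gt0. Qed.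

Lemma scaleS j : scale j.+1 = (5 ^ ((j * j).+1 + 2 * j))%N.
Proof. by rewrite /scale; congr expn; lia. Qed.

Lemma delay_gt c j : (j < delay c j)%N.
Proof.
by elim: j => [//|j IHj] /=; have := scale_gt0 j; case: (c j); lia.
Qed.

Lemma delayS_le c j : (delay c j <= scale j)%N ->
  (delay c j.+1 <= 5 ^ (j * j).+1)%N.
Proof. by rewrite expnS -/(scale j) /=; case: (c j); lia. Qed.

Lemma delay_le c j : (delay c j <= scale j)%N.
Proof.
elim: j => [//|j /delayS_le IHj]; apply: leq_trans IHj _.
by rewrite scaleS leq_exp2l// leq_addr.
Qed.

(** As [delay c j.+1] is at most [5^(j * j + 1)], it is below [scale j.+1] by a
factor [5^(2 * j)], which is at least [j.+1]. *)
Lemma delay_negligible c j : (j * delay c j <= scale j)%N.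
Proof.
case: j => [//|j]; have := delayS_le (delay_le c j); rewrite scaleS expnD.
have : (j.+1 <= 5 ^ (2 * j))%N.
  by apply: leq_ltn_trans (ltn_expl (2 * j) (isT : (1 < 5)%N)); lia.
by move: (5 ^ _)%N (5 ^ _)%N (delay _ _) => a b d; nia.
Qed.

(** The suffixes of lengths [delay c j] are prefixes of one another
([coded_seq_step]) and define a sequence; letter [i] may be read in the suffix of
index [i], because [i < delay c i]. *)
Definition coded_seq (R : realType) (c : nat -> bool) : Sigma2 R :=
  fun i => seq_u R (scale i - (delay c i - i))%N.

Lemma coded_seq_step (R : realType) c j i : (i < delay c j)%N ->
  seq_u R (scale j.+1 - (delay c j.+1 - i))%N =
  seq_u R (scale j - (delay c j - i))%N.
Proof.
move=> ij; have := delayS_le (delay_le c j); have := delay_le c j.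
have := scale_gt0 j => s0 ds dSs; rewrite scaleS seq_u_suffix; last first.
  by apply/andP; split; move: dSs; rewrite /=; lia.
rewrite expnS -/(scale j) /=.
(* The digit [d] at this scale is even, hence leaves the letter unchanged. *)
pose d := (if c j then 2 else 0)%N.
rewrite (_ : _ - _ = d * scale j + (scale j - (delay c j - i)))%N.
  by rewrite /d seq_u_top_digit//; case: (c j) => //; rewrite -/(scale j); lia.
by rewrite /d; case: (c j); lia.
Qed.

Lemma coded_seqE (R : realType) c j i : (i < delay c j)%N ->
  coded_seq R c i = seq_u R (scale j - (delay c j - i))%N.
Proof.
have stable k l : (i < delay c k)%N ->
    seq_u R (scale (k + l) - (delay c (k + l) - i))%N =
    seq_u R (scale k - (delay c k - i))%N.
  move=> ik; have ikl m : (i < delay c (k + m))%N.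
    elim: m => [|m IHm]; first by rewrite addn0.
    by rewrite addnS /=; lia.
  elim: l => [|l IHl]; first by rewrite addn0.
  by rewrite addnS coded_seq_step.
move=> ij; rewrite /coded_seq -(stable _ j (delay_gt c i)) addnC.
exact: stable.
Qed.

Lemma coded_seq_block (R : realType) c j i :
  (delay c j <= i < delay c j + scale j)%N -> coded_seq R c i = c j.
Proof.
move=> /andP[ji ij]; have s0 := scale_gt0 j.
have ds := delay_le c j; have dSs := delayS_le ds.
have iS : (i < delay c j.+1)%N by rewrite /=; case: (c j); lia.
rewrite (coded_seqE R iS) scaleS seq_u_suffix; last first.
  by apply/andP; split; lia.
rewrite expnS -/(scale j) /=.
(* The digit following the one chosen at this scale selects a block I or O. *)
pose d := (if c j then 3 else 1)%N.
rewrite (_ : _ - _ = d * scale j + (i - delay c j))%N.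
  by rewrite /d seq_u_top_digit//; case: (c j) => //; rewrite -/(scale j); lia.
by rewrite /d; case: (c j); lia.
Qed.

Lemma coded_seq_omega_u (R : realType) c : omega_u (coded_seq R c).
Proof.
apply/omega_uP => n m; pose p := (scale m - delay c m)%N.
have dm := delay_gt c m; have ds := delay_le c m.
(* Adding a leading digit 2 moves the occurrence at [p] as far as needed. *)
exists (2 * 5 ^ (m * m + n) + p)%N.
  have : (5 ^ n <= 5 ^ (m * m + n))%N by rewrite leq_exp2l// leq_addl.
  by have := ltn_expl n (isT : (1 < 5)%N); lia.
move=> i im; have sm : (scale m <= 5 ^ (m * m + n))%N.
  by rewrite leq_exp2l// leq_addr.
rewrite -addnA seq_u_top_digit//= /p; last by lia.
by rewrite (coded_seqE R (j := m)); [congr seq_u|]; lia.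
Qed.

Definition coded_point (R : realType) (c : nat -> bool) : @omega_u R :=
  exist _ (coded_seq R c) (mem_set (@coded_seq_omega_u R c)).

Lemma coded_pointE (R : realType) c : set_val (coded_point R c) = coded_seq R c.
Proof. by []. Qed.

(** * Distributional chaos *)

Lemma hausdorff_orbit_le (R : realType) i (x y : @omega_u R) : (0 < i)%N ->
  hausdorff_dist (iter_image (F_u R) i x) (iter_image (F_u R) i y) <=
  mdist (iter i (@sigma_u R) x) (iter i (@sigma_u R) y).
Proof.
by move=> i0; rewrite !iter_imageE// hausdorff_dist_pair ge_max !ge_min !lexx.
Qed.

(** One of [sigma^i(x)] and [sigma^i(y)] begins with 1; it is at distance at least 1
both from the other one and from [a]. *)
Lemma hausdorff_orbit_ge1 (R : realType) i (x y : @omega_u R) : (0 < i)%N ->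
  set_val x i != set_val y i ->
  1 <= hausdorff_dist (iter_image (F_u R) i x) (iter_image (F_u R) i y).
Proof.
move=> i0 xy; rewrite !iter_imageE// hausdorff_dist_pair.
have far (z w : @omega_u R) : set_val z 0%N != set_val w 0%N -> 1 <= mdist z w.
  by move=> /rho_disagree; rewrite expr0 invr1.
rewrite le_max !le_min (far (iter i _ x)) ?iter_sigma_uE ?addn0//=.
apply/orP; case xi: (set_val x i) xy => yi; [left|right]; apply: far.
  by rewrite iter_sigma_uE addn0 xi.
by rewrite iter_sigma_uE addn0.
Qed.

Lemma two_power_lt (R : realType) (t : R) : 0 < t ->
  exists m, 2 / 2 ^+ m < t.
Proof.
move=> t0; have [m] : exists m : nat, 0 + m.+1%:R^-1 < t / 2.
  by apply: ltr_add_invr; rewrite divr_gt0.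
rewrite add0r ltr_pdivlMr// mulrC => mt; exists m; apply: le_lt_trans mt.
rewrite ler_pM2l// lef_pV2 ?posrE ?ltr0n ?exprn_gt0//.
by rewrite -natrX ler_nat ltn_expl.
Qed.

(** At the indices [j] where [c] and [c'] agree, both points are constant with the
same letter from the larger delay until [scale j]; the times that remain are those
before that delay, and the last [m] ones, where the first [m] letters may go
beyond the time [scale j]. *)
Lemma coded_points_close (R : realType) (c c' : nat -> bool) :
  (forall N, exists2 j, (N <= j)%N & c j = c' j) ->
  forall t : R, 0 < t ->
  limn_esup (frequency (fun i => hausdorff_dist
    (iter_image (F_u R) i (coded_point R c))
    (iter_image (F_u R) i (coded_point R c')) < t)) = 1%E :> \bar R.
Proof.
move=> cc' t t0; have [m mt] := two_power_lt t0.
apply: limn_esup_frequency_eq1 => K N.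
have [j] := cc' (2 * K + 2 * K * m + N)%N.
have := delay_negligible c j; have := delay_negligible c' j.
have := delay_gt c j; have := delay_gt c' j.
set d := delay c j; set d' := delay c' j => jd' jd js' js Nj cj.
exists (scale j); split; [by nia|by rewrite scale_gt0|].
apply: (@leq_trans (K * (maxn d d' + m))%N); last first.
  by rewrite mulnDr maxnMr; nia.
rewrite leq_mul2l; apply/orP; right; apply: hits_le_window => i is_ /negP.
rewrite -leNgt => ti; have [|di] := ltnP i (maxn d d'); first by left.
right; rewrite leqNgt; apply/negP => im; move: ti; apply/negP; rewrite -ltNge.
rewrite geq_max in di; have /andP[di1 di2] := di.
apply: le_lt_trans mt; apply: le_trans (hausdorff_orbit_le _ _ _) _; first by lia.
apply: rho_le_agree => l lm; rewrite !iter_sigma_uE !coded_pointE.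
by rewrite !(@coded_seq_block _ _ j) -/d -/d'; lia.
Qed.

Lemma coded_points_apart (R : realType) (c c' : nat -> bool) :
  (forall N, exists2 j, (N <= j)%N & c j != c' j) ->
  limn_einf (frequency (fun i => hausdorff_dist
    (iter_image (F_u R) i (coded_point R c))
    (iter_image (F_u R) i (coded_point R c')) < 1)) = 0%E :> \bar R.
Proof.
move=> cc'; apply: limn_einf_frequency_eq0 => K N.
have [j] := cc' (K + N)%N.
have := delay_negligible c j; have := delay_negligible c' j.
have := delay_gt c j; have := delay_gt c' j.
set d := delay c j; set d' := delay c' j => jd' jd js' js Nj cj.
exists (scale j); split; [by nia|by rewrite scale_gt0|].
apply: (@leq_trans (K * (maxn d d' + 0))%N); last first.
  by rewrite addn0 maxnMr; nia.
rewrite leq_mul2l; apply/orP; right; apply: hits_le_window => i is_.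
rewrite ltNge => /negP ti; have [|di] := ltnP i (maxn d d'); first by left.
case: ti; apply: hausdorff_orbit_ge1; rewrite geq_max in di;
  have /andP[di1 di2] := di; first by lia.
by rewrite !coded_pointE !(@coded_seq_block _ _ j) -/d -/d'//; lia.
Qed.

Lemma coded_seq_scale (R : realType) c j : coded_seq R c (scale j) = c j.
Proof.
apply: coded_seq_block; have := delay_le c j; have := delay_gt c j; lia.
Qed.

(** Each letter [alpha k] is repeated at all indices of 2-adic valuation [k + 1], and
odd indices carry the letter 0. *)
Definition code (alpha : nat -> bool) (j : nat) : bool :=
  (0 < logn 2 j)%N && alpha (logn 2 j).-1.

Lemma logn2_cofinal v N : exists2 j, (N <= j)%N & logn 2 j = v.
Proof.
exists (2 ^ v * N.*2.+1)%N; first by have := expn_gt0 2 v; nia.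
rewrite lognM ?expn_gt0// pfactorK// logn_coprime ?addn0//.
by rewrite coprime2n /= odd_double.
Qed.

(** Cantor's diagonal argument. *)
Lemma bool_seq_uncountable : ~ countable [set: nat -> bool].
Proof.
move=> /countable_injP[f /= finj].
pose delta n := `[< forall alpha, f alpha = n -> ~~ alpha n >].
have [dd|/negP nd] := boolP (delta (f delta)).
  by have /asboolP/(_ delta erefl) := dd; rewrite dd.
apply: (nd); apply/asboolP => alpha /(finj _ _ _ _) -> //; rewrite ?inE//.
exact/negP.
Qed.

(** Two codes agree at all odd indices, and a letter on which [alpha] and [beta]
differ is repeated infinitely often. *)
Lemma code_agree alpha beta N : exists2 j, (N <= j)%N & code alpha j = code beta j.
Proof. by have [j Nj j0] := logn2_cofinal 0 N; exists j; rewrite // /code j0. Qed.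

Lemma code_differ alpha beta : alpha <> beta ->
  forall N, exists2 j, (N <= j)%N & code alpha j != code beta j.
Proof.
move=> ab N; have [k abk] : exists k, alpha k != beta k.
  apply: contrapT => nab; apply: ab; apply/funext => k.
  by apply/eqP/negPn/negP => abk; apply: nab; exists k.
have [j Nj jk] := logn2_cofinal k.+1 N; exists j => //.
by rewrite /code jk.
Qed.

Lemma coded_point_inj (R : realType) :
  injective (fun alpha => coded_point R (code alpha)).
Proof.
move=> alpha beta E; apply: contrapT => /code_differ/(_ 0%N)[j _ /eqP]; apply.
have := congr1 (fun x => set_val x (scale j)) E.
by rewrite /= !coded_pointE !coded_seq_scale.
Qed.

Lemma F_u_chaotic (R : realType) : hausdorff_distributionally_chaotic (F_u R).
Proof.
exists (range (fun alpha => coded_point R (code alpha))); split.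
  move=> /countable_injP[f finj]; apply: bool_seq_uncountable.
  apply/countable_injP; exists (fun alpha => f (coded_point R (code alpha))).
  move=> alpha beta _ _ /finj E; apply: (@coded_point_inj R); apply: E.
    by rewrite inE; exists alpha.
  by rewrite inE; exists beta.
move=> _ _ [alpha _ <-] [beta _ <-] ab /=; split.
  by apply: coded_points_close; exact: code_agree.
exists 1 => //; apply: coded_points_apart; apply: code_differ => E.
by apply: ab; rewrite E.
Qed.

Theorem mainTheorem5 (R : realType) :
  (pt_a R <> pt_b R /\ [set x | strongly_nonwandering (F_u R) x] = [set pt_a R; pt_b R]) /\
  hausdorff_distributionally_chaotic (F_u R).
Proof.
split; last exact: F_u_chaotic.
split; first by move=> /(congr1 (fun x => set_val x 0%N)).
apply/seteqP; split=> x; first exact: strongly_nonwandering_fixed.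
case=> ->; apply: fixed_strongly_nonwandering.
  exact: sigma_u_pt_a.
exact: sigma_u_pt_b.
Qed.
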